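(* Let $E=\mathbb{R}$ and let $\psi:\mathbb{R}\to[0,\infty)$ be a continuous function satisfying $\psi\ge1$ outside some compact set. Let $\mathcal{P}$ be a class of probability measures on $(\Omega,\mathcal{F})=(\mathbb{R}^{\mathbb{N}},\mathcal{B}(\mathbb{R})^{\mathbb{N}})$ such that (a) $\mathbb{P}_1=\mathbb{P}_2=\cdots$ for all $\mathbb{P}\in\mathcal{P}$, (b) $\lim_{K\to\infty}\sup_{\mathbb{P}\in\mathcal{P}}\int\psi(y)\mathbf{1}_{\{\psi(y)\ge K\}}\,\mathbb{P}_1(dy)=0$, (c) $\lim_{n\to\infty}\sup_{\mathbb{P}\in\mathcal{P}}\alpha_{\mathbb{P}}(n)=0$. Then, for every $\delta>0$, $$\lim_{n\to\infty}\ \sup_{\mathbb{P}\in\mathcal{P}}\ \mathbb{P}\bigl[d_{\psi,\text{Lévy}}(\widehat m_n,\mathbb{P}_1)\ge\delta\bigr]=0.$$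
   Context: Here $X_i$ is the $i$th coordinate projection on $\Omega:=\mathbb{R}^{\mathbb{N}}$ (with product $\sigma$-field $\mathcal{F}$), and $\mathbb{P}_i:=\mathbb{P}\circ X_i^{-1}$ is the $i$th marginal distribution of a probability measure $\mathbb{P}$ on $(\Omega,\mathcal{F})$. The empirical probability measure is $\widehat m_n(x):=\frac1n\sum_{i=1}^n\delta_{x_i}$ for $x=(x_1,x_2,\ldots)\in\Omega$. The Lévy metric on probability measures on $(\mathbb{R},\mathcal{B}(\mathbb{R}))$ is $$d_{\text{Lévy}}(\mu,\nu):=\inf\{\varepsilon>0:F_\mu(x-\varepsilon)-\varepsilon\le F_\nu(x)\le F_\mu(x+\varepsilon)+\varepsilon\text{ for all }x\in\mathbb{R}\},$$ where $F_\mu,F_\nu$ are the distribution functions of $\mu,\nu$. On the set $\mathcal{M}_1^\psi(\mathbb{R})$ of probability measures $\mu$ on $(\mathbb{R},\mathcal{B}(\mathbb{R}))$ with $\int\psi\,d\mu<\infty$, set $$d_{\psi,\text{Lévy}}(\mu,\nu):=d_{\text{Lévy}}(\mu,\nu)+\Bigl|\int\psi\,d\mu-\int\psi\,d\nu\Bigr|.$$ The $n$th strong mixing coefficient of the coordinate process under $\mathbb{P}$ is $\alpha_{\mathbb{P}}(n):=\sup_{k\ge1}\sup_{A,B}|\mathbb{P}[A\cap B]-\mathbb{P}[A]\mathbb{P}[B]|$, where the inner supremum ranges over all $A\in\sigma(X_1,\ldots,X_k)$ and $B\in\sigma(X_{k+n},X_{k+n+1},\ldots)$. *)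

(* Defs.v *)
From HB Require Import structures.
From mathcomp Require Import all_boot all_order all_algebra.
From mathcomp Require Import all_classical all_reals all_analysis.

Set Implicit Arguments.
Unset Strict Implicit.
Unset Printing Implicit Defensive.

Import Order.TTheory GRing.Theory Num.Theory.
Import numFieldNormedType.Exports.

Local Open Scope classical_set_scope.
Local Open Scope ring_scope.

(* Sequences are indexed from 0: [x i] stands for $x_{i+1}$, so that the
   coordinate projection $X_{i+1}$ is [Xproj i]. *)
Definition cylinders (R : realType) (I : set nat) : set_system (nat -> R) :=
  \bigcup_(i in I) preimage_set_system setT (fun x : nat -> R => x i) measurable.

(* $\mathbb{R}^{\mathbb{N}}$ with the product sigma-field *)
Definition Omega (R : realType) := g_sigma_algebraType (@cylinders R setT).
HB.instance Definition _ (R : realType) := Measurable.on (Omega R).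

Definition Xproj (R : realType) (i : nat) (x : Omega R) : R := x i.

Section Xproj_measurable.
Context (R : realType) (i : nat).

Let measurable_Xproj : measurable_fun [set: Omega R] (@Xproj R i).
Proof.
move=> _ B mB; rewrite setTI; apply: sub_sigma_algebra.
by exists i => //; exists B => //; rewrite setTI.
Qed.

HB.instance Definition _ :=
  isMeasurableFun.Build _ _ (Omega R) R (@Xproj R i) measurable_Xproj.

End Xproj_measurable.

(* $\mathbb{P}_{i+1}$ *)
Definition marginal (R : realType) (P : probability (Omega R) R) (i : nat) :
  probability R R := distribution P (@Xproj R i).

(* $\sigma(X_{i+1} : i \in I)$ *)
Definition sigma_coord (R : realType) (I : set nat) : set_system (Omega R) :=
  <<s @cylinders R I >>.

(* The past $\sigma(X_1,\dots,X_k)$ uses the indices $i < k$, the future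
   $\sigma(X_{k+n},X_{k+n+1},\dots)$ the indices with $k + n \le i + 1$. *)
Definition alpha_mixing (R : realType) (P : probability (Omega R) R) (n : nat) :
    \bar R :=
  ereal_sup [set r | exists (k : nat) (A B : set (Omega R)),
    [/\ (1 <= k)%N,
        sigma_coord [set i | (i < k)%N] A,
        sigma_coord [set i | (k + n <= i.+1)%N] B &
        r = `|P (A `&` B) - P A * P B|%E] ].

Section empirical.
Context (R : realType) (n : nat) (x : Omega R).

(* $\widehat m_{n+1}(x)$, defined only for positive sample sizes so that it is
   a probability measure *)
Definition empirical : set R -> \bar R :=
  mscale (n.+1%:R^-1)%:nng (msum (fun i => \d_(x i) : {measure set R -> \bar R}) n.+1).

HB.instance Definition _ := Measure.on empirical.

Let empirical_setT : empirical setT = 1%E.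
Proof.
transitivity (((n.+1%:R^-1 : R)%:E * \sum_(i < n.+1) (\d_(x i) [set: R] : \bar R))%E) => //.
rewrite (eq_bigr (fun=> 1%:E)) => [|i _]; last exact: diracT.
by rewrite sumEFin sumr_const card_ord -EFinM mulVf// pnatr_eq0.
Qed.

HB.instance Definition _ :=
  Measure_isProbability.Build _ _ _ empirical empirical_setT.

End empirical.

Definition distr_fun (R : realType) (mu : probability R R) (x : R) : R :=
  fine (mu `]-oo, x]%classic).

Definition d_Levy (R : realType) (mu nu : probability R R) : R :=
  inf [set e : R | 0 < e /\ forall x : R,
    distr_fun mu (x - e) - e <= distr_fun nu x <= distr_fun mu (x + e) + e].

(* To be used for [mu] and [nu] with finite [psi]-moment only: the real-valued
   integral is 0 by convention when the [psi]-moment is infinite. *)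
Definition d_psi_Levy (R : realType) (psi : R -> R) (mu nu : probability R R) : R :=
  d_Levy mu nu + `|\int[mu]_y psi y - \int[nu]_y psi y|.

(* Supremum of a nonnegative function, i.e. taken in $[0,+\infty]$: adding 0
   only matters when [A] is empty, where [ereal_sup] would yield [-oo]. *)
Definition sup_nonneg (R : realType) (T : Type) (A : set T) (f : T -> \bar R) :
    \bar R :=
  ereal_sup ([set 0%E] `|` f @` A).

(* Main.v *)
(** Everything reduces to one estimate, uniform over the class and over Borel
sets [B]: expanding the variance of the empirical frequency of [B] into
covariances, each bounded by a mixing coefficient, and applying Chebyshev's
inequality bounds the probability that this frequency deviates from its
expectation by [eta] by [2 / eta^2] times a Cesàro mean of the (uniform) mixing
coefficients. For the Lévy distance, finitely many half-lines ending at
quantiles of the marginal suffice; their number does not depend on the marginal,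
so no tightness is needed. For the [psi]-moment, [psi] is approximated up to
[eps] by [eps * sum_(k < N) 1_{psi >= (k+1) eps}], except on [{psi >= N eps}],
where Markov's inequality and uniform integrability take over. *)

From HB Require Import structures.
Require Import Defs.
From mathcomp Require Import all_boot all_order all_algebra.
From mathcomp Require Import all_classical all_reals all_analysis measurable_realfun.
From mathcomp Require Import ring lra.

Set Implicit Arguments.
Unset Strict Implicit.
Unset Printing Implicit Defensive.

Import Order.TTheory GRing.Theory Num.Theory.
Import numFieldNormedType.Exports.
Local Open Scope classical_set_scope.
Local Open Scope ring_scope.

(** * Distribution functions and quantiles *)

Section distribution_function.
Context (R : realType) (mu : probability R R).

Local Notation F := (distr_fun mu).

Lemma distr_fun_nd x y : x <= y -> F x <= F y.
Proof.
by move=> xy; rewrite fine_le ?fin_num_measure// le_measure ?inE//; exact: subitvPr.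
Qed.

Lemma distr_fun_ge0 x : 0 <= F x. Proof. exact: fine_ge0. Qed.

Lemma distr_fun_le1 x : F x <= 1.
Proof. by rewrite -lee_fin fineK ?fin_num_measure// probability_le1. Qed.

Lemma distr_fun_le_open x q : x < q -> F x <= fine (mu `]-oo, q[%classic).
Proof.
move=> xq; rewrite fine_le ?fin_num_measure// le_measure ?inE//.
by apply: subset_itvl; rewrite bnd_simp.
Qed.

(** As a random variable under [mu], the identity has cumulative distribution function
    [distr_fun mu]; this gives access to the known limits of such functions at both infinities. *)
Let idR : R -> R := idfun.
#[local] HB.instance Definition _ :=
  @isMeasurableFun.Build _ _ _ _ idR (@measurable_id _ _ setT).

Lemma distr_fun_cvgy1 : F x @[x --> +oo] --> (1 : R).
Proof. exact: (fine_cvg (cvg_cdfy1 (idR : {RV mu >-> R}))). Qed.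

Lemma distr_fun_cvgNy0 : F x @[x --> -oo] --> (0 : R).
Proof. exact: (fine_cvg (cvg_cdfNy0 (idR : {RV mu >-> R}))). Qed.

(** The infimum of all [y] with [a <= F y] works: below it [F] stays under [a], above it [F] is at
    least [a], and both bounds pass to the limit along an increasing union and a decreasing
    intersection of half-lines. *)
Lemma quantile_exists (a : R) : 0 < a < 1 ->
  exists q, fine (mu `]-oo, q[%classic) <= a <= fine (mu `]-oo, q]%classic).
Proof.
move=> /andP[a0 a1].
pose S := [set y | a <= F y].
have S0 : S !=set0.
  have /cvgr_gt/(_ a a1) := distr_fun_cvgy1.
  move=> [M [_ +]]; move/(_ (M + 1)); rewrite ltrDl ltr01 => /(_ isT) h.
  by exists (M + 1); exact: ltW.
have [z zS] : exists z, F z < a.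
  have /cvgr_lt/(_ a a0) := distr_fun_cvgNy0.
  move=> [M [_ +]]; move/(_ (M - 1)); rewrite gtrBl ltr01 => /(_ isT) h.
  by exists (M - 1).
have lbS : has_lbound S.
  exists z => x Sx; rewrite leNgt; apply/negP => xz.
  by have := le_lt_trans (le_trans Sx (distr_fun_nd (ltW xz))) zS; rewrite ltxx.
have ltS (x : R) : x < inf S -> F x < a.
  by move=> xS; rewrite ltNge; apply/negP => /(ge_inf lbS); rewrite leNgt xS.
have gtS (x : R) : inf S < x -> a <= F x.
  move=> /inf_lt-/(_ S0)[w Sw wx]; exact: le_trans Sw (distr_fun_nd (ltW wx)).
exists (inf S); apply/andP; split.
- pose A n := `]-oo, inf S - n.+1%:R^-1]%classic.
  have -> : `]-oo, inf S[%classic = \bigcup_n A n.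
    apply/seteqP; split=> [x/=|x [n _]]; rewrite /A /= !in_itv/=.
      by move=> /ltr_add_invr[k xk]; exists k => //=; rewrite in_itv/= lerBrDr ltW.
    by move=> /le_lt_trans; apply; rewrite ltrBlDr ltrDl.
  have : mu (A n) @[n --> \oo] --> mu (\bigcup_n A n).
    apply: nondecreasing_cvg_mu.
    - by move=> n; rewrite /A.
    - by apply: bigcup_measurable => n _; rewrite /A.
    move=> n m nm; apply/subsetPset => x.
    rewrite /A/= !in_itv/= => /le_trans; apply.
    by rewrite lerD2l lerN2 lef_pV2 ?posrE// ler_nat.
  rewrite -[X in _ --> X]fineK; last first.
    by rewrite fin_num_measure//; apply: bigcup_measurable => n _; rewrite /A.
  move/fine_cvg => cA.
  apply: (cvgr_to_le cA).
  by apply: nearW => n; apply/ltW/ltS; rewrite ltrBlDr ltrDl.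
- have : mu `]-oo, inf S + n.+1%:R^-1]%classic @[n --> \oo] --> mu `]-oo, inf S]%classic.
    rewrite (itvNycEbigcap false).
    apply: nonincreasing_cvg_mu => //=.
    + by rewrite -ge0_fin_numE// fin_num_measure.
    + exact: bigcap_measurable.
    + move=> n m nm; apply/subsetPset; apply: subset_itvl.
      by rewrite bnd_simp lerD2l lef_pV2 ?posrE// ler_nat.
  rewrite -[X in _ --> X]fineK ?fin_num_measure//.
  move/fine_cvg => cA.
  apply: (cvgr_to_ge cA).
  by apply: nearW => n; apply: gtS; rewrite ltrDl.
Qed.

End distribution_function.

(** * The Lévy distance and its control by finitely many half-lines *)

Section Levy_distance.
Context (R : realType).
Implicit Types mu nu : probability R R.

Let Levy_set mu nu : set R := [set e : R | 0 < e /\ forall x : R,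
  distr_fun mu (x - e) - e <= distr_fun nu x <= distr_fun mu (x + e) + e].

Let Levy_set_lbound mu nu : has_lbound (Levy_set mu nu).
Proof. by exists 0 => e [/ltW]. Qed.

(** Shifting the argument by [e] only relaxes the inequalities, by monotonicity; so the Lévy
    distance is dominated by the Kolmogorov distance. *)
Lemma d_Levy_le mu nu (e : R) : 0 < e ->
  (forall x, `|distr_fun mu x - distr_fun nu x| <= e) -> d_Levy mu nu <= e.
Proof.
move=> e0 h; apply: ge_inf; first exact: Levy_set_lbound.
split=> // x; have := h x; rewrite ler_norml => /andP[h1 h2].
have := @distr_fun_nd _ mu (x - e) x; have := @distr_fun_nd _ mu x (x + e).
rewrite lerDl gerBl ltW// => /(_ isT) ? /(_ isT) ?.
by apply/andP; split; lra.
Qed.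

(* Enlarging [e] leaves room to move the quantified point to a nearby
   rational, by monotonicity of distribution functions. *)
Lemma d_Levy_ltP mu nu (c : R) : d_Levy mu nu < c <->
  exists e : rat, [/\ 0 < ratr e :> R, ratr e < c & forall t : rat,
    distr_fun mu (ratr t - ratr e) - ratr e <= distr_fun nu (ratr t)
      <= distr_fun mu (ratr t + ratr e) + ratr e].
Proof.
split.
- move=> /inf_lt-[].
    (* Distribution functions take values in [[0, 1]], so [1] is admissible and the infimum runs
       over a nonempty set. *)
    exists 1; split => // x; apply/andP; split.
      have := distr_fun_le1 mu (x - 1); have := distr_fun_ge0 nu x; lra.
    have := distr_fun_ge0 mu (x + 1); have := distr_fun_le1 nu x; lra.
  move=> e [e0 eS] ec; have [r] := rat_in_itvoo ec.
  rewrite in_itv/= => /andP[er rc]; exists r; split => // [|t].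
    exact: lt_trans er.
  have /andP[h1 h2] := eS (ratr t).
  have := @distr_fun_nd _ mu (ratr t - ratr r) (ratr t - e).
  have := @distr_fun_nd _ mu (ratr t + e) (ratr t + ratr r).
  rewrite !lerD2l lerN2 ltW// => /(_ isT) ? /(_ isT) ?.
  by apply/andP; split; lra.
- move=> [e [e0 ec eS]].
  have [e' ] := rat_in_itvoo ec; rewrite in_itv/= => /andP[ee' e'c].
  apply: le_lt_trans e'c; apply: ge_inf; first exact: Levy_set_lbound.
  split=> [|x]; first exact: lt_trans ee'.
  have [r] := @rat_in_itvoo _ (x - (ratr e' - ratr e)) x ltac:(lra).
  rewrite in_itv/= => /andP[r1 r2].
  have [s] := @rat_in_itvoo _ x (x + (ratr e' - ratr e)) ltac:(lra).
  rewrite in_itv/= => /andP[s1 s2].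
  have /andP[+ _] := eS r; have /andP[_ +] := eS s.
  have := @distr_fun_nd _ mu (x - ratr e') (ratr r - ratr e) ltac:(lra).
  have := @distr_fun_nd _ mu (ratr s + ratr e) (x + ratr e') ltac:(lra).
  have := @distr_fun_nd _ nu (ratr r) x ltac:(lra).
  have := @distr_fun_nd _ nu x (ratr s) ltac:(lra).
  by move=> *; apply/andP; split; lra.
Qed.

(** Discretisation as in the Glivenko-Cantelli theorem: the [k/m]-quantiles of [mu] trap [x] between
    two levels, and monotonicity of [nu] does the rest. The sets are chosen before [nu], which will
    be random. *)
Lemma uniform_distance_le mu (m : nat) : (0 < m)%N ->
  exists B : nat -> set R, (forall k, measurable (B k)) /\
  forall nu (eta : R), 0 <= eta ->
    (forall k, (k < m.*2)%N -> `|fine (nu (B k)) - fine (mu (B k))| <= eta) ->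
    forall x, `|distr_fun nu x - distr_fun mu x| <= m%:R^-1 *+ 2 + eta.
Proof.
move=> m0.
have mR : 0 < m%:R :> R by rewrite ltr0n.
have /boolp.choice[q hq] : forall k, exists q : R, (0 < k < m)%N ->
    fine (mu `]-oo, q[%classic) <= k%:R / m%:R <= fine (mu `]-oo, q]%classic).
  (* Outside [0 < k < m] the value is a dummy; these levels are settled below by [0 <= F <= 1]. *)
  move=> k; have [/andP[k0 km]|_] := boolP (0 < k < m)%N; last by exists 0.
  have [|q h] := @quantile_exists _ mu (k%:R / m%:R); last by exists q.
  by rewrite divr_gt0 ?ltr0n//= ltr_pdivrMr// mul1r ltr_nat.
(* Both half-lines ending at [q k] are tested, because of possible atoms: the open one serves for
   [x < q k], the closed one for [q k <= x]. *)
pose B k := if odd k then `]-oo, q k./2[%classic else `]-oo, q k./2]%classic.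
exists B; split=> [k|nu eta eta0 hB x]; first by rewrite /B; case: ifP.
have hB1 k : (k < m)%N ->
    `|fine (nu `]-oo, q k[%classic) - fine (mu `]-oo, q k[%classic)| <= eta.
  move=> km; have := hB k.*2.+1; rewrite /B /= odd_double/= uphalf_double; apply.
  by rewrite ltn_Sdouble.
have hB2 k : (k < m)%N ->
    `|fine (nu `]-oo, q k]%classic) - fine (mu `]-oo, q k]%classic)| <= eta.
  by move=> km; have := hB k.*2; rewrite /B /= odd_double/= doubleK; apply; rewrite ltn_double.
have up k : distr_fun mu x < k%:R / m%:R -> distr_fun nu x <= k%:R / m%:R + eta.
  move=> Fk; have [mk|km] := leqP m k.
    rewrite (le_trans (distr_fun_le1 _ _))// ler_wpDr//.
    by rewrite ler_pdivlMr// mul1r ler_nat.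
  have k0 : (0 < k)%N.
    by rewrite lt0n; apply/eqP => k0; move: Fk; rewrite k0 mul0r ltNge distr_fun_ge0.
  have /andP[q1 q2] := hq k (introT andP (conj k0 km)).
  have xq : x < q k.
    rewrite ltNge; apply/negP => qx.
    have := le_lt_trans (le_trans q2 (distr_fun_nd mu qx)) Fk.
    by rewrite ltxx.
  have := hB1 _ km; rewrite ler_norml => /andP[_].
  have : distr_fun nu x <= fine (nu `]-oo, q k[%classic) by exact: distr_fun_le_open.
  lra.
have lo k : k%:R / m%:R < distr_fun mu x -> k%:R / m%:R - eta <= distr_fun nu x.
  move=> kF.
  have km : (k < m)%N.
    have := lt_le_trans kF (distr_fun_le1 _ _).
    by rewrite ltr_pdivrMr// mul1r ltr_nat.
  have [->|k0] := posnP k.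
    by rewrite mul0r sub0r (le_trans _ (distr_fun_ge0 _ _))// oppr_le0.
  have /andP[q1 q2] := hq k (introT andP (conj k0 km)).
  have qx : q k <= x.
    rewrite leNgt; apply/negP => xq.
    have : distr_fun mu x <= fine (mu `]-oo, q k[%classic) by exact: distr_fun_le_open.
    lra.
  have := hB2 _ km; rewrite ler_norml => /andP[+ _].
  have : fine (nu `]-oo, q k]%classic) <= distr_fun nu x by exact: distr_fun_nd.
  lra.
have mF0 : 0 <= m%:R * distr_fun mu x by rewrite mulr_ge0// distr_fun_ge0.
have /andP[j1 j2] := truncn_itv mF0.
set j := Num.truncn _ in j1 j2.
have Fj : distr_fun mu x < j.+1%:R / m%:R by rewrite ltr_pdivlMr// mulrC.
have jF : j%:R / m%:R <= distr_fun mu x by rewrite ler_pdivrMr// mulrC.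
have := up _ Fj; move: Fj jF; rewrite -natr1 mulrDl mul1r => Fj jF upj.
have im0 : 0 < (m%:R^-1 : R) by rewrite invr_gt0.
(* [lo] asks for a strict inequality whereas [j/m] may equal [F x]; stepping down to the level
   [j.-1] costs the second [m%:R^-1]. *)
have : distr_fun mu x - m%:R^-1 *+ 2 - eta <= distr_fun nu x.
  have [j0|j0] := posnP j.
    move: Fj; rewrite j0 mul0r; have := distr_fun_ge0 nu x; lra.
  have := lo j.-1; move: Fj jF {up lo upj}; rewrite -[in j%:R](prednK j0) -natr1 mulrDl mul1r.
  lra.
by rewrite ler_norml => h; apply/andP; split; lra.
Qed.

End Levy_distance.

(** * Covariance sums and Chebyshev's inequality *)

(** Each distance occurs at most twice, once on either side of [i]. *)
Lemma sum_distance_le (R : numDomainType) (c : nat -> R) (n : nat) (i : 'I_n) :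
  (forall k, 0 <= c k) ->
  \sum_(j < n) c (if (i <= j)%N then (j - i)%N else (i - j)%N)
    <= 2 * \sum_(0 <= k < n) c k.
Proof.
move=> c0.
rewrite -(big_mkord xpredT (fun j => c (if (i <= j)%N then (j - i)%N else (i - j)%N))).
rewrite (big_cat_nat _ (n := i))//=; last exact: ltnW.
have sub m : (m <= n)%N -> \sum_(0 <= k < m) c k <= \sum_(0 <= k < n) c k.
  by move=> mn; rewrite (big_cat_nat _ mn)//= lerDl sumr_ge0.
rewrite mulr_natl mulr2n; apply: lerD.
(* Read backwards, the indices before [i] have distances [1, ..., i]. *)
- rewrite big_nat_rev/= add0n.
  apply: (@le_trans _ _ (\sum_(0 <= k < i) c k.+1)).
    rewrite le_eqVlt; apply/orP; left; apply/eqP; apply: eq_big_nat => k /andP[_ ki].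
    by rewrite leqNgt ltn_subrL (leq_ltn_trans _ ki)//= subKn.
  rewrite -(big_add1 _ _ 0 i.+1 xpredT c).
  by rewrite (le_trans _ (sub i.+1 (ltn_ord i)))// [leRHS]big_ltn// lerDr.
- rewrite -[X in \sum_(X <= _ < _) _]add0n big_addn.
  under eq_bigr do rewrite leq_addl addnK.
  exact/sub/leq_subr.
Qed.

Section second_moment.
Context d (T : measurableType d) (R : realType) (P : probability T R).

Lemma Lfun_indic (A : set T) (r : R) : measurable A -> r != 0 ->
  (\1_A : T -> R) \in Lfun P r%:E.
Proof.
move=> mA r0; rewrite inE/=; apply/andP; split; rewrite inE//=.
rewrite /finite_norm unlock poweR_lty//.
under eq_integral => x _.
  rewrite /= (_ : `|\1_A x| `^ r = \1_A x)%R; last first.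
    by rewrite indicE; case: (x \in A); rewrite ?normr1 ?powR1// normr0 powR0.
  over.
by rewrite integral_indic// setIT -ge0_fin_numE// fin_num_measure.
Qed.

(** Links covariances to mixing: the right-hand side is the quantity inside the absolute value
    defining [alpha_mixing]. *)
Lemma covariance_indic (A B : set T) : measurable A -> measurable B ->
  covariance P (\1_A : T -> R) (\1_B : T -> R) = (P (A `&` B) - P A * P B)%E.
Proof.
move=> mA mB.
have AB : (\1_A * \1_B)%R = \1_(A `&` B) :> (T -> R) by rewrite indicI.
rewrite covarianceE ?AB.
- by rewrite !expectation_indic//; exact: measurableI.
- exact: Lfun_indic.
- exact: Lfun_indic.
- by apply: Lfun_indic => //; exact: measurableI.
Qed.

Let two_ge1 : (1 <= (2 : R)%:E)%E.
Proof. by rewrite lee_fin ler1n. Qed.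

Lemma Lfun2_sum (I : Type) (s : seq I) (X : I -> T -> R) :
  (forall i, X i \in Lfun P 2%:E) -> (\sum_(i <- s) X i) \in Lfun P 2%:E.
Proof.
move=> X2; elim: s => [|i s ih]; first by rewrite big_nil; exact: (Lfun_cst P 0).
by rewrite big_cons rpredD.
Qed.

Lemma covariance_suml (I : Type) (s : seq I) (X : I -> T -> R) (Y : T -> R) :
  (forall i, X i \in Lfun P 2%:E) -> Y \in Lfun P 2%:E ->
  covariance P (\sum_(i <- s) X i) Y = (\sum_(i <- s) covariance P (X i) Y)%E.
Proof.
move=> X2 Y2; elim: s => [|i s ih].
  by rewrite !big_nil; exact: (covariance_cst_l P 0).
by rewrite !big_cons -ih; apply: covarianceDl => //; exact: Lfun2_sum.
Qed.

Lemma variance_sum (I : Type) (s : seq I) (X : I -> T -> R) :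
  (forall i, X i \in Lfun P 2%:E) ->
  'V_P[\sum_(i <- s) X i] =
    (\sum_(i <- s) \sum_(j <- s) covariance P (X i) (X j))%E.
Proof.
move=> X2; rewrite /variance covariance_suml ?Lfun2_sum//.
apply: eq_bigr => i _.
by rewrite covarianceC covariance_suml//; apply: eq_bigr => j _; exact: covarianceC.
Qed.

(** Each of the [N.+1] rows of the covariance matrix sums to at most twice the sum of the [c k];
    dividing by the square of [N.+1 * eta] leaves a Cesàro mean. *)
Lemma indicator_sum_chebyshev (A : nat -> set T) (p eta : R) (N : nat) (c : nat -> R) :
    (forall i, measurable (A i)) -> (forall i, P (A i) = p%:E) ->
    (forall k, 0 <= c k) ->
    (forall i j, (i <= j)%N ->
      `|P (A i `&` A j) - P (A i) * P (A j)|%E <= (c (j - i)%N)%:E)%E ->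
    0 < eta ->
  (P [set x | (eta <= `|N.+1%:R^-1 * (\sum_(i < N.+1) \1_(A i) x) - p|)%R]
   <= (eta ^- 2 * (2 * (N.+1%:R^-1 * \sum_(0 <= k < N.+1) c k)))%:E)%E.
Proof.
move=> mA PA c0 cA eta0.
have I2 i : (\1_(A i) : T -> R) \in Lfun P 2%:E by exact: Lfun_indic.
pose S : T -> R := \sum_(i < N.+1) \1_(A i).
have SE x : S x = \sum_(i < N.+1) \1_(A i) x by rewrite /S fct_sumE.
have S2 : S \in Lfun P 2%:E by apply: Lfun2_sum => i.
have mS : measurable_fun setT S.
  by have := S2; rewrite inE => /andP[/[!inE]].
pose RS : {RV P >-> R} := HB.pack S (isMeasurableFun.Build _ _ _ _ S mS).
have ES : ('E_P[S] = (N.+1%:R * p)%:E)%E.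
  rewrite /S -(big_map (fun i : 'I_N.+1 => \1_(A i) : T -> R) xpredT id).
  rewrite expectation_sum.
    rewrite big_map; under eq_bigr do rewrite expectation_indic// PA.
    by rewrite sumEFin sumr_const card_ord mulr_natl.
  by move=> _ /mapP[i _ ->]; apply: Lfun_indic.
have VS : ('V_P[S] <= (N.+1%:R * (2 * \sum_(0 <= k < N.+1) c k))%:E)%E.
  rewrite /S variance_sum//.
  have row (i : 'I_N.+1) :
    (\sum_(j < N.+1) covariance P (\1_(A i) : T -> R) (\1_(A j) : T -> R)
      <= (2 * \sum_(0 <= k < N.+1) c k)%:E)%E.
    apply: (@le_trans _ _
      (\sum_(j < N.+1) c (if (i <= j)%N then (j - i)%N else (i - j)%N))%:E); last first.
      by rewrite lee_fin; exact: sum_distance_le.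
    rewrite -sumEFin; apply: lee_sum => j _.
    rewrite covariance_indic// (le_trans (lee_abs _))//.
    have [/cA//|/ltnW ji] := leqP i j.
    (* [cA] covers ordered pairs of indices; the others follow by symmetry. *)
    by rewrite setIC muleC; exact: cA.
  rewrite (le_trans (lee_sum _ (fun i _ => row i)))// sumEFin sumr_const card_ord.
  by rewrite lee_fin le_eqVlt -[X in X == _]mulr_natl eqxx.
have N0 : 0 < (N.+1%:R : R) by rewrite ltr0n.
have := @chebyshev _ _ _ P RS (N.+1%:R * eta) (mulr_gt0 N0 eta0).
rewrite [fine _](_ : _ = N.+1%:R * p)/=; last by rewrite ES.
rewrite [X in P X](_ : _ =
    [set x | eta <= `|N.+1%:R^-1 * (\sum_(i < N.+1) \1_(A i) x) - p|]); last first.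
  apply/funext => x; apply/propext => /=; rewrite -SE.
  have -> : S x - N.+1%:R * p = N.+1%:R * (N.+1%:R^-1 * S x - p).
    by rewrite mulrBr mulVKf ?gt_eqF.
  by rewrite normrM (gtr0_norm N0) ler_pM2l.
move=> /le_trans; apply.
apply: (@le_trans _ _
  (((N.+1%:R * eta) ^- 2)%:E * (N.+1%:R * (2 * \sum_(0 <= k < N.+1) c k))%:E)%E).
  by rewrite lee_pmul2l// lte_fin invr_gt0 exprn_gt0// mulr_gt0.
rewrite -EFinM lee_fin le_eqVlt; apply/orP; left; apply/eqP.
by field; rewrite !gt_eqF.
Qed.

End second_moment.

(** * Mixing coefficients and empirical frequencies *)

Section mixing.
Context (R : realType) (P : probability (Omega R) R).

Lemma sigma_coord_Xproj (I : set nat) (i : nat) (B : set R) :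
  I i -> measurable B -> sigma_coord I (@Xproj R i @^-1` B).
Proof.
move=> Ii mB; apply: sub_sigma_algebra; exists i => //.
by exists B => //; rewrite setTI.
Qed.

Lemma sigma_coord_measurable (I : set nat) (A : set (Omega R)) :
  sigma_coord I A -> measurable A.
Proof.
by apply: sub_sigma_algebra2; exact: bigcup_subset.
Qed.

(** Guarantees that the supremum of the coefficients over the class is finite, hence a real
    number. *)
Lemma alpha_mixing_le1 (n : nat) : (alpha_mixing P n <= 1)%E.
Proof.
apply: ge_ereal_sup => _ [k [A [B [k0 sA sB ->]]]].
have [mA mB] := (sigma_coord_measurable sA, sigma_coord_measurable sB).
have mAB := measurableI _ _ mA mB.
have p0 (C : set (Omega R)) : 0 <= fine (P C) by exact: fine_ge0.
have p1 C (mC : measurable C) : fine (P C) <= 1.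
  by rewrite -lee_fin fineK ?fin_num_measure//; exact: probability_le1.
rewrite -[P A]fineK ?fin_num_measure// -[P B]fineK ?fin_num_measure//.
rewrite -[P (_ `&` _)]fineK ?fin_num_measure//.
rewrite -EFinM -EFinB abse_EFin lee_fin.
have := mulr_ge0 (p0 A) (p0 B); have := mulr_ile1 (p0 A) (p0 B) (p1 _ mA) (p1 _ mB).
have := p0 (A `&` B); have := p1 _ mAB.
by rewrite ler_norml => *; apply/andP; split; lra.
Qed.

Lemma alpha_mixing_ge (i j : nat) (B C : set R) : (i <= j)%N ->
    measurable B -> measurable C ->
  (`|P (@Xproj R i @^-1` B `&` @Xproj R j @^-1` C)
     - P (@Xproj R i @^-1` B) * P (@Xproj R j @^-1` C)|
   <= alpha_mixing P (j - i))%E.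
Proof.
(* With a past of length [i.+1] and lag [j - i], the future starts exactly at index [j], since
   [i.+1 + (j - i) = j.+1]. The case [i = j] uses lag 0. *)
move=> ij mB mC; apply: ereal_sup_ubound; exists i.+1.
exists (@Xproj R i @^-1` B), (@Xproj R j @^-1` C); split => //.
- by apply: sigma_coord_Xproj => /=.
- by apply: sigma_coord_Xproj => //=; rewrite addSn subnKC.
Qed.

Lemma empiricalE (n : nat) (x : Omega R) (B : set R) :
  fine (empirical n x B) = n.+1%:R^-1 * \sum_(i < n.+1) \1_B (x i).
Proof.
transitivity (fine ((n.+1%:R^-1 : R)%:E * \sum_(i < n.+1) (\d_(x i) B : \bar R))%E) => //.
by under eq_bigr do rewrite diracE -indicE; rewrite sumEFin.
Qed.

(** The bound does not involve [B], and involves [P] only through [c]; this is the source of all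
    uniformity. *)
Lemma empirical_deviation (c : nat -> R) (n : nat) (B : set R) (eta : R) :
    (forall (i : nat) (B : set R), measurable B -> marginal P i B = marginal P 0 B) ->
    (forall k, 0 <= c k) -> (forall k, alpha_mixing P k <= (c k)%:E)%E ->
    measurable B -> 0 < eta ->
  (P [set x | (eta <= `|fine (empirical n x B) - fine (marginal P 0 B)|)%R]
   <= (eta ^- 2 * (2 * (n.+1%:R^-1 * \sum_(0 <= k < n.+1) c k)))%:E)%E.
Proof.
move=> Pid c0 alphac mB eta0.
have PB i : P (@Xproj R i @^-1` B) = (fine (marginal P 0 B))%:E.
  by rewrite fineK ?fin_num_measure//; exact: Pid.
under eq_set do rewrite empiricalE.
apply: (@indicator_sum_chebyshev _ _ _ P (fun i => @Xproj R i @^-1` B)) => //.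
- by move=> i; rewrite -[X in measurable X]setTI; exact: measurable_funP.
- by move=> i j ij; apply: le_trans (alphac _); exact: alpha_mixing_ge.
Qed.

End mixing.

(** * Measurability of empirical frequencies and distances *)

Section empirical_measurability.
Context (R : realType) (n : nat).

Lemma measurable_empirical_mean (h : R -> R) : measurable_fun setT h ->
  measurable_fun setT (fun x : Omega R => n.+1%:R^-1 * \sum_(i < n.+1) h (x i)).
Proof.
move=> mh; apply: measurable_funM => //.
apply: measurable_sum => i.
exact: (measurableT_comp mh (measurable_funP (@Xproj R i))).
Qed.

Lemma measurable_empirical (B : set R) : measurable B ->
  measurable_fun setT (fun x : Omega R => fine (empirical n x B)).
Proof.
move=> mB.
have -> : (fun x : Omega R => fine (empirical n x B)) =
    (fun x : Omega R => n.+1%:R^-1 * \sum_(i < n.+1) \1_B (x i)).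
  by apply/funext => x; exact: empiricalE.
by apply: measurable_empirical_mean; exact: measurable_indic.
Qed.

(** By [d_Levy_ltP], the event that the distance is below [c] is a countable combination, over
    rationals, of conditions on frequencies of half-lines. *)
Lemma measurable_d_Levy_empirical (mu : probability R R) :
  measurable_fun setT (fun x : Omega R => d_Levy (empirical n x) mu).
Proof.
move=> mT; apply: (measurability _ (RGenInftyO.measurableE R)) => //.
move=> /= _ [_ [c ->] <-].
rewrite setTI.
pose A (e t : rat) : set (Omega R) :=
  [set x | distr_fun (empirical n x) (ratr t - ratr e) <= distr_fun mu (ratr t) + ratr e] `&`
  [set x | distr_fun mu (ratr t) - ratr e <= distr_fun (empirical n x) (ratr t + ratr e)].
(* The intersection over [t] is written as the complement of a union; the constraints on [e] do not
   depend on [x] and become case distinctions. *)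
rewrite (_ : _ @^-1` _ = \bigcup_(e : rat)
    if 0 < ratr e :> R then if ratr e < c then
      ~` \bigcup_(t : rat) ~` A e t else set0 else set0).
  apply: bigcupT_measurable_rat => e; case: ifP => // _; case: ifP => // _.
  apply: measurableC; apply: bigcupT_measurable_rat => t; apply: measurableC.
  have mF s := measurable_empirical (measurable_itv `]-oo, s]).
  apply: measurableI; rewrite -[X in measurable X]setTI;
    apply: measurable_fun_le => //; exact: mF.
apply/seteqP; split=> x /=.
  rewrite in_itv/= => /d_Levy_ltP[e [e0 ec h]]; exists e => //.
  rewrite e0 ec => -[t _]; apply.
  by have := h t; rewrite !lerBlDr => /andP[h1 h2]; split; rewrite /= ?lerBlDr.
move=> [e _]; case: ifPn => // e0; case: ifPn => // ec hx.
rewrite in_itv/=; apply/d_Levy_ltP; exists e; split => // t.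
have [h1 h2] : A e t x by apply: contrapT => At; apply: hx; exists t.
by apply/andP; rewrite lerBlDr -[in X in _ /\ X]lerBlDr.
Qed.

End empirical_measurability.

(** * Empirical means and Markov's inequality *)

Section empirical_integral.
Context (R : realType).

Lemma integral_empirical (n : nat) (x : Omega R) (h : R -> R) :
    measurable_fun setT h -> (forall y, 0 <= h y) ->
  (\int[empirical n x]_y (h y)%:E = (n.+1%:R^-1 * \sum_(i < n.+1) h (x i))%:E)%E.
Proof.
move=> mh h0.
have mEh : measurable_fun setT (EFin \o h) by exact/measurable_EFinP.
have Eh0 y : setT y -> (0 <= (EFin \o h) y)%E by move=> _; rewrite /= lee_fin.
rewrite ge0_integral_mscale// ge0_integral_measure_sum//.
under eq_bigr do rewrite integral_dirac// diracT mul1e/=.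
by rewrite sumEFin -EFinM.
Qed.

(** Since the marginals coincide, linearity makes the integral on the right the expectation of the
    empirical mean of [h]. *)
Lemma markov_empirical (P : probability (Omega R) R) (n : nat) (h : R -> R) (eta : R) :
    (forall (i : nat) (B : set R), measurable B -> marginal P i B = marginal P 0 B) ->
    measurable_fun setT h -> (forall y, 0 <= h y) -> 0 < eta ->
  (eta%:E * P [set x | (eta <= n.+1%:R^-1 * \sum_(i < n.+1) h (x i))%R]
   <= \int[marginal P 0]_y (h y)%:E)%E.
Proof.
move=> Pid mh h0 eta0.
have mX := measurable_empirical_mean n mh.
pose X : {RV P >-> R} := HB.pack (fun x : Omega R => n.+1%:R^-1 * \sum_(i < n.+1) h (x i))
  (isMeasurableFun.Build _ _ _ _ _ mX).
have X0 x : 0 <= X x by rewrite mulr_ge0// sumr_ge0.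
have := @markov _ _ _ P X id eta eta0 (@measurable_id _ _ setT) (fun r r0 => r0)
  (fun x y _ _ xy => xy).
have -> : [set x | (eta%:E <= `|(X x)%:E|)%E] =
    [set x : Omega R | (eta <= n.+1%:R^-1 * \sum_(i < n.+1) h (x i))%R].
  by apply/funext => x/=; rewrite lee_fin ger0_norm//; exact: X0.
move=> /le_trans; apply; rewrite unlock.
have mX_ (i : nat) : measurable_fun setT (fun x : Omega R => (h (x i))%:E).
  apply/measurable_EFinP.
  exact: (measurableT_comp mh (measurable_funP (@Xproj R i))).
have IX (i : nat) : (\int[P]_x (h (x i))%:E = \int[marginal P 0]_y (h y)%:E)%E.
  transitivity (\int[marginal P i]_y (h y)%:E)%E; last first.
    by apply: eq_measure_integral => B mB _; exact: Pid.
  have mEh : measurable_fun setT (EFin \o h) by exact/measurable_EFinP.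
  have Eh0 y : (0 <= (EFin \o h) y)%E by rewrite /= lee_fin.
  rewrite -[RHS]/(\int[distribution P (@Xproj R i)]_y (EFin \o h) y)%E.
  by rewrite ge0_integral_distribution.
rewrite (_ : (\int[P]_x _ =
    \int[P]_x (n.+1%:R^-1%:E * \sum_(i < n.+1) (h (x i))%:E))%E); last first.
  apply: eq_integral => x _ /=; rewrite sumEFin -EFinM ger0_norm//; exact: X0.
rewrite ge0_integralZl_EFin//; last 2 first.
- by move=> x _; rewrite sumEFin lee_fin sumr_ge0.
- by apply: emeasurable_sum => i.
rewrite ge0_integral_sum//; last by move=> i x _; rewrite lee_fin.
under eq_bigr do rewrite IX -[integral _ _ _]mul1e.
rewrite -ge0_sume_distrl// sumEFin sumr_const card_ord muleA -EFinM mulVf ?pnatr_eq0// mul1e.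
exact: lexx.
Qed.

End empirical_integral.

(** * Layer approximation of the [psi]-moment *)

(** The integrand of the uniform integrability condition at level [K]. *)
Definition upper_part (R : realType) (psi : R -> R) (K y : R) : R :=
  psi y * \1_[set z | K <= psi z] y.

Section moment_comparison.
Context (R : realType) (psi : R -> R) (eps : R) (N : nat).
Hypotheses (psi_ge0 : forall y, 0 <= psi y) (mpsi : measurable_fun setT psi).
Hypothesis eps_gt0 : 0 < eps.

Local Notation A k := [set y | k.+1%:R * eps <= psi y].
Local Notation tail := (upper_part psi (N%:R * eps)).
Let layers (y : R) : R := \sum_(k < N) \1_(A k) y.

Lemma upper_part_ge0 K y : 0 <= upper_part psi K y.
Proof. by rewrite mulr_ge0// indicE. Qed.

Lemma superlevel_measurable (a : R) : measurable [set y | a <= psi y].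
Proof.
rewrite -[X in measurable X]setTI.
by apply: measurable_fun_le => //; exact: measurable_cst.
Qed.

Lemma measurable_upper_part K : measurable_fun setT (upper_part psi K).
Proof.
apply: measurable_funM => //; apply: measurable_indic; exact: superlevel_measurable.
Qed.

Let layersE y : layers y = (minn N (Num.truncn (psi y / eps)))%:R.
Proof.
rewrite /layers.
have t0 : 0 <= psi y / eps by rewrite divr_ge0// ltW.
rewrite (eq_bigr (fun k : 'I_N => (k < Num.truncn (psi y / eps))%N%:R)); last first.
  move=> k _.
  rewrite indicE; congr (_%:R); congr nat_of_bool; apply/idP/idP.
    by rewrite inE/= => h; rewrite truncn_ge_nat// ler_pdivlMr.
  by rewrite truncn_ge_nat// ler_pdivlMr// inE.
rewrite -natr_sum; congr (_%:R).
elim: N => [|n ih]; first by rewrite big_ord0 min0n.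
rewrite big_ord_recr/= ih; have [nj|jn] := ltnP n (Num.truncn (psi y / eps)).
  by rewrite (minn_idPl nj) addn1.
by rewrite (minn_idPr (leqW jn)) addn0.
Qed.

(** If the integer part of [psi y / eps] is at most [N], rounding costs less than [eps]; otherwise
    [psi y] exceeds [N * eps] and [tail y] is [psi y] itself. *)
Let layers_bounds y : eps * layers y <= psi y <= eps * layers y + eps + tail y.
Proof.
have t0 : 0 <= psi y / eps by rewrite divr_ge0// ltW.
have /andP[j1 j2] := truncn_itv t0.
rewrite layersE; set j := Num.truncn _ in j1 j2 *.
rewrite ler_pdivlMr// in j1; rewrite ltr_pdivrMr// -natr1 mulrDl mul1r in j2.
have := upper_part_ge0 (N%:R * eps) y; rewrite /upper_part indicE.
have [jN|Nj] := leqP j N; last first.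
  rewrite mem_set/=; last first.
    by apply: le_trans j1; rewrite ler_pM2r// ler_nat ltnW.
  rewrite mulr1 => _; have := psi_ge0 y.
  have : N%:R * eps <= j%:R * eps by rewrite ler_pM2r// ler_nat ltnW.
  have : 0 <= N%:R * eps by rewrite mulr_ge0// ltW.
  by move=> *; apply/andP; split; lra.
by move=> ?; apply/andP; split; lra.
Qed.

Lemma moment_bounds (mu : probability R R) :
    (\int[mu]_y (tail y)%:E < +oo)%E ->
  eps * (\sum_(k < N) fine (mu (A k))) <= \int[mu]_y psi y <=
  eps * (\sum_(k < N) fine (mu (A k))) + eps + fine (\int[mu]_y (tail y)%:E).
Proof.
move=> tailoo.
have mA k : measurable (A k) by exact: superlevel_measurable.
have ml : measurable_fun setT layers.
  by apply: measurable_sum => k; exact: measurable_indic.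
have l0 y : 0 <= layers y by apply: sumr_ge0 => k _; rewrite indicE.
have Il : (\int[mu]_y (eps * layers y)%:E = (eps * \sum_(k < N) fine (mu (A k)))%:E)%E.
  rewrite (_ : (\int[mu]_y _ =
      \int[mu]_y (eps%:E * \sum_(k < N) (\1_(A k) y)%:E))%E); last first.
    by apply: eq_integral => y _; rewrite sumEFin EFinM.
  rewrite ge0_integralZl_EFin//; last 3 first.
  - by move=> x _; rewrite sumEFin lee_fin l0.
  - by apply: emeasurable_sum => i; apply/measurable_EFinP; exact: measurable_indic.
  - exact: ltW.
  rewrite ge0_integral_sum//; last first.
    by move=> i; apply/measurable_EFinP; exact: measurable_indic.
  rewrite EFinM -sumEFin; congr (_ * _)%E; apply: eq_bigr => k _.
  by rewrite integral_indic// setIT fineK// fin_num_measure.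
have mEl : measurable_fun setT (fun y => (eps * layers y)%:E).
  by apply/measurable_EFinP; exact: measurable_funM.
have mEpsi : measurable_fun setT (EFin \o psi) by exact/measurable_EFinP.
have mEt : measurable_fun setT (EFin \o tail).
  by apply/measurable_EFinP; exact: measurable_upper_part.
have lo : ((eps * \sum_(k < N) fine (mu (A k)))%:E <= \int[mu]_y (psi y)%:E)%E.
  rewrite -Il; apply: ge0_le_integral => //.
  - by move=> y _; rewrite lee_fin mulr_ge0// ltW.
  - by move=> y _; rewrite lee_fin; have /andP[] := layers_bounds y.
have up : (\int[mu]_y (psi y)%:E <=
    (eps * (\sum_(k < N) fine (mu (A k))) + eps)%:E + \int[mu]_y (tail y)%:E)%E.
  rewrite EFinD -Il -[X in (_ + X%:E + _)%E]mulr1.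
  have -> : ((eps * 1)%:E = \int[mu]_y (cst eps%:E y))%E.
    by rewrite integral_cst// EFinM; congr (_ * _)%E; exact/esym/probability_setT.
  have e0 y : setT y -> (0 <= (eps * layers y)%:E)%E.
    by move=> _; rewrite lee_fin mulr_ge0// ltW.
  have mlc := emeasurable_funD mEl (measurable_cst eps%:E).
  rewrite -ge0_integralD//; last by move=> y _; rewrite lee_fin ltW.
  rewrite -ge0_integralD//; last 2 first.
  - by move=> y _; rewrite adde_ge0// ?e0// lee_fin ltW.
  - by move=> y _; rewrite lee_fin upper_part_ge0.
  apply: ge0_le_integral => //.
  - by move=> y _; rewrite lee_fin.
  - exact: (emeasurable_funD mlc mEt).
  - by move=> y _; rewrite /= -!EFinD lee_fin; have /andP[] := layers_bounds y.
have tfin : (\int[mu]_y (tail y)%:E)%E \is a fin_num.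
  by rewrite ge0_fin_numE// integral_ge0// => y _; rewrite lee_fin upper_part_ge0.
(* Finiteness follows from the upper bound [up]; it excludes the default value 0 of the real-valued
   integral. *)
have pfin : (\int[mu]_y (psi y)%:E)%E \is a fin_num.
  rewrite ge0_fin_numE ?integral_ge0//; last by move=> y _; rewrite lee_fin.
  by rewrite (le_lt_trans up)// -(fineK tfin) -EFinD ltry.
rewrite /Rintegral; apply/andP; split.
  by rewrite -lee_fin fineK.
by rewrite -lee_fin fineK// EFinD fineK.
Qed.

End moment_comparison.

(** * Deviations of the weighted Lévy distance *)

Section weighted_deviation.
Context (R : realType) (psi : R -> R).
Hypotheses (psi_ge0 : forall y, 0 <= psi y) (mpsi : measurable_fun setT psi).

(** The deterministic part. The Lévy distance contributes [2 * a] (quantile spacing and tolerance),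
    the moments [3 * a] (rounding, tail, and accumulated deviations of the [N] layers). *)
Lemma d_psi_Levy_small (mu : probability R R) (a : R) (m N : nat) :
    0 < a -> (0 < m)%N -> m%:R^-1 *+ 2 <= a ->
    (\int[mu]_y (upper_part psi (N%:R * a) y)%:E <= a%:E)%E ->
  exists C : nat -> set R, (forall k, measurable (C k)) /\
    forall nu : probability R R,
      (forall k, (k < m.*2 + N)%N ->
        `|fine (nu (C k)) - fine (mu (C k))| <= a / (1 + a * N%:R)) ->
      (\int[nu]_y (upper_part psi (N%:R * a) y)%:E <= a%:E)%E ->
      d_psi_Levy psi nu mu <= 5 * a.
Proof.
move=> a0 m0 ma mu_tail.
have [B [mB hB]] := uniform_distance_le mu m0.
pose A k := [set y | k.+1%:R * a <= psi y].
exists (fun k => if (k < m.*2)%N then B k else A (k - m.*2)%N).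
split=> [k|nu near_mu nu_tail].
  by case: ifP => // _; exact: superlevel_measurable.
have aN0 : 0 < 1 + a * N%:R by rewrite ltr_pwDl// mulr_ge0// ltW.
(* This tolerance meets both [eta <= a], for the Lévy distance, and [a * (N * eta) <= a], for the
   layers. *)
pose eta := a / (1 + a * N%:R).
have eta0 : 0 <= eta by rewrite divr_ge0// ltW.
have eta_a : eta <= a by rewrite ler_pdivrMr// (ler_peMr (ltW a0))// lerDl mulr_ge0// ltW.
have etaN : a * (N%:R * eta) <= a.
  rewrite /eta mulrCA mulrA mulrA ler_pdivrMr//.
  have : 0 <= a * N%:R by rewrite mulr_ge0// ltW.
  by nra.
have dL : d_Levy nu mu <= 2 * a.
  apply: d_Levy_le => [|x]; first by rewrite mulr_gt0.
  apply: (le_trans (hB nu eta eta0 _ x)); last by rewrite mulr_natl [a *+ 2]mulr2n lerD.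
  by move=> k km; have := near_mu k; rewrite km; apply; rewrite ltn_addr.
have nearA : `|\sum_(k < N) fine (nu (A k)) - \sum_(k < N) fine (mu (A k))| <= N%:R * eta.
  rewrite -sumrB (le_trans (ler_norm_sum _ _ _))//.
  rewrite (le_trans (ler_sum _ (_ : forall k : 'I_N, _ -> _ <= eta)))//.
    move=> k _; have := near_mu (m.*2 + k)%N.
    have -> : (m.*2 + k < m.*2)%N = false by rewrite ltnNge leq_addr.
    by rewrite addKn ltn_add2l; apply.
  by rewrite sumr_const card_ord mulr_natl.
have tail_le (l : probability R R) :
    (\int[l]_y (upper_part psi (N%:R * a) y)%:E <= a%:E)%E ->
    fine (\int[l]_y (upper_part psi (N%:R * a) y)%:E)%E <= a.
  move=> h; rewrite -lee_fin fineK// ge0_fin_numE ?(le_lt_trans h (ltry _))//.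
  by apply: integral_ge0 => y _; rewrite lee_fin upper_part_ge0.
have /andP[] := moment_bounds psi_ge0 mpsi a0 (le_lt_trans mu_tail (ltry _)).
have /andP[] := moment_bounds psi_ge0 mpsi a0 (le_lt_trans nu_tail (ltry _)).
have := tail_le _ mu_tail; have := tail_le _ nu_tail; rewrite /d_psi_Levy -/A.
move: nearA; rewrite -(ler_pM2l a0) => /le_trans/(_ etaN).
rewrite -[X in X * `|_|](gtr0_norm a0) -normrM mulrBr ler_norml => /andP[].
have : `|\int[nu]_y psi y - \int[mu]_y psi y| <= 3 * a ->
  d_Levy nu mu + `|\int[nu]_y psi y - \int[mu]_y psi y| <= 5 * a by lra.
move=> + n1 n2 t1 t2 b1 b2 b3 b4; apply.
by rewrite ler_norml; apply/andP; split; lra.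
Qed.

Lemma measurable_d_psi_Levy_empirical (n : nat) (mu : probability R R) :
  measurable_fun setT (fun x : Omega R => d_psi_Levy psi (empirical n x) mu).
Proof.
apply: measurable_funD; first exact: measurable_d_Levy_empirical.
have -> : (fun x : Omega R => `|\int[empirical n x]_y psi y - \int[mu]_y psi y|) =
    (@Num.norm _ R) \o (fun x : Omega R =>
      n.+1%:R^-1 * \sum_(i < n.+1) psi (x i) - \int[mu]_y psi y).
  by apply/funext => x /=; rewrite /Rintegral integral_empirical.
apply: measurableT_comp => //; apply: measurable_funB => //.
exact: measurable_empirical_mean.
Qed.

(** A union bound: one mixing estimate for each of the [m.*2 + N] test sets, and Markov's inequality
    for the empirical tail. *)
Lemma d_psi_Levy_deviation (P : probability (Omega R) R) (c : nat -> R) (a : R)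
    (m N n : nat) :
    (forall (i : nat) (B : set R), measurable B -> marginal P i B = marginal P 0 B) ->
    (forall k, 0 <= c k) -> (forall k, alpha_mixing P k <= (c k)%:E)%E ->
    0 < a -> (0 < m)%N -> m%:R^-1 *+ 2 <= a ->
    (\int[marginal P 0]_y (upper_part psi (N%:R * a) y)%:E <= a%:E)%E ->
  (P [set x | (6 * a <= d_psi_Levy psi (empirical n x) (marginal P 0))%R] <=
   ((m.*2 + N)%:R * ((a / (1 + a * N%:R)) ^- 2 *
      (2 * (n.+1%:R^-1 * \sum_(0 <= k < n.+1) c k))))%:E
   + a^-1%:E * \int[marginal P 0]_y (upper_part psi (N%:R * a) y)%:E)%E.
Proof.
move=> Pid c0 alphac a0 m0 ma tail_a.
have [C [mC hC]] := d_psi_Levy_small a0 m0 ma tail_a.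
set eta := a / _ in hC *.
have eta0 : 0 < eta by rewrite divr_gt0// ltr_pwDl// mulr_ge0// ltW.
have mu_ := measurable_upper_part mpsi (N%:R * a).
have u0 := upper_part_ge0 psi_ge0 (N%:R * a).
pose M := (m.*2 + N)%N.
pose F k : set (Omega R) := if (k < M)%N
  then [set x | eta <= `|fine (empirical n x (C k)) - fine (marginal P 0 (C k))|]
  else [set x | a <= n.+1%:R^-1 * \sum_(i < n.+1) upper_part psi (N%:R * a) (x i)].
have mle (f : Omega R -> R) (b : R) : measurable_fun setT f -> measurable [set x | b <= f x].
  move=> mf; rewrite -[X in measurable X]setTI.
  by apply: measurable_fun_le => //; exact: measurable_cst.
have mF k : measurable (F k).
  rewrite /F; case: ifP => _; apply: mle; last exact: measurable_empirical_mean.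
  apply: measurableT_comp => //; apply: measurable_funB => //.
  exact: measurable_empirical.
apply: (le_trans (@content_subadditive _ _ _ P _ F M.+1 _ _ _)) => //.
- by apply: mle; exact: measurable_d_psi_Levy_empirical.
- move=> x /= far; rewrite -bigcup_mkord; apply: contrapT => nF.
  (* Off the bad events the distance is at most [5 * a], strictly below the threshold [6 * a]. *)
  suff : d_psi_Levy psi (empirical n x) (marginal P 0) <= 5 * a.
    by rewrite leNgt (lt_le_trans _ far)// ltr_pM2r// ltr_nat.
  apply: hC => [k kM|].
    rewrite leNgt; apply/negP => /ltW h; apply: nF; exists k; first exact: leqW.
    by rewrite /F kM.
  rewrite integral_empirical// lee_fin leNgt; apply/negP => /ltW h.
  by apply: nF; exists M => //=; rewrite /F ltnn.
- rewrite big_ord_recr/=; apply: leeD.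
    apply: (@le_trans _ _ (\sum_(k < M)
        (eta ^- 2 * (2 * (n.+1%:R^-1 * \sum_(0 <= k < n.+1) c k)))%:E)%E).
      by apply: lee_sum => k _; rewrite /F ltn_ord; exact: empirical_deviation.
    by rewrite sumEFin sumr_const card_ord lee_fin -[X in X <= _]mulr_natl.
  by rewrite /F ltnn lee_pdivlMl//; exact: markov_empirical.
Qed.

End weighted_deviation.

(** * Suprema over the class *)

Section sup_nonneg.
Context (R : realType) (T : Type) (A : set T) (f : T -> \bar R).

Lemma sup_nonneg_ge0 : (0 <= sup_nonneg A f)%E.
Proof. by apply: ereal_sup_ubound; left. Qed.

Lemma sup_nonneg_ubound x : A x -> (f x <= sup_nonneg A f)%E.
Proof. by move=> Ax; apply: ereal_sup_ubound; right; exists x. Qed.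

Lemma sup_nonneg_le M : (0 <= M)%E -> (forall x, A x -> f x <= M)%E ->
  (sup_nonneg A f <= M)%E.
Proof. by move=> M0 fM; apply: ge_ereal_sup => _ [->//|[x Ax <-]]; exact: fM. Qed.

End sup_nonneg.

(** * Choice of the parameters, uniformly over the class *)

Theorem corollary3p11 (R : realType) (psi : R -> R)
  (psi_ge0 : forall y : R, 0 <= psi y)
  (psi_cont : continuous psi)
  (psi_ge1 : exists C : set R, compact C /\ forall y : R, ~ C y -> 1 <= psi y)
  (PP : set (probability (Omega R) R))
  (ident_marginals : forall P : probability (Omega R) R, PP P ->
     forall (i : nat) (B : set R), measurable B ->
       marginal P i B = marginal P 0 B)
  (unif_integrable :
     sup_nonneg PP (fun P : probability (Omega R) R =>
       \int[marginal P 0]_y (psi y * \1_[set z : R | K <= psi z] y)%:E)%E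
     @[K --> +oo] --> 0%E)
  (unif_mixing :
     sup_nonneg PP (fun P : probability (Omega R) R => alpha_mixing P n)
     @[n --> \oo] --> 0%E)
  (delta : R) (delta_gt0 : 0 < delta) :
  sup_nonneg PP (fun P : probability (Omega R) R =>
    P [set x : Omega R | delta <= d_psi_Levy psi (empirical n x) (marginal P 0)])
  @[n --> \oo] --> 0%E.
Proof.
have mpsi : measurable_fun setT psi := continuous_measurable_fun psi_cont.
pose abar n := sup_nonneg PP (fun P : probability (Omega R) R => alpha_mixing P n).
pose c n := fine (abar n).
have abar_fin n : abar n \is a fin_num.
  rewrite ge0_fin_numE ?sup_nonneg_ge0//; apply: (@le_lt_trans _ _ 1%E) (ltry _).
  by apply: sup_nonneg_le => // P _; exact: alpha_mixing_le1.
have c0 n : 0 <= c n by apply: fine_ge0; exact: sup_nonneg_ge0.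
have alphac P : PP P -> forall k, (alpha_mixing P k <= (c k)%:E)%E.
  move=> PPP k; rewrite fineK//.
  exact: (@sup_nonneg_ubound _ _ PP (fun P => alpha_mixing P k)).
have c_cvg : c n @[n --> \oo] --> (0 : R) by case: ((fine_cvgP _ _).1 unif_mixing).
pose v n := n.+1%:R^-1 * \sum_(0 <= k < n.+1) c k.
have v_cvg : v n @[n --> \oo] --> (0 : R) by exact: cesaro.
pose a := delta / 6.
have a0 : 0 < a by rewrite divr_gt0.
have aE : delta = 6 * a by rewrite /a mulrC divfK.
have ev_small (kappa : R) : 0 < kappa -> \forall n \near \oo,
    (sup_nonneg PP (fun P : probability (Omega R) R =>
      P [set x : Omega R | (delta <= d_psi_Levy psi (empirical n x) (marginal P 0))%R])
     <= kappa%:E)%E.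
  move=> kappa0.
  (* The bound [a] makes [d_psi_Levy_deviation] applicable; the other bound keeps the Markov term
     [a^-1 * tau] below [kappa / 2]. *)
  pose tau := Num.min a (a * (kappa / 2)).
  have tau0 : 0 < tau by rewrite lt_min a0 !mulr_gt0.
  have [N tailN] : exists N : nat, forall P, PP P ->
      (\int[marginal P 0]_y (upper_part psi (N%:R * a) y)%:E <= tau%:E)%E.
    have [/= tail_fin /cvgrPdist_le/(_ _ tau0) tail_small] :=
      (fine_cvgP _ _).1 unif_integrable.
    have [K [_ hK]] : \forall K \near +oo,
      (sup_nonneg PP (fun P : probability (Omega R) R =>
        \int[marginal P 0]_y (psi y * \1_[set z : R | K <= psi z] y)%:E) <= tau%:E)%E.
      near=> K.
      have Kfin : sup_nonneg PP (fun P : probability (Omega R) R =>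
        \int[marginal P 0]_y (psi y * \1_[set z : R | K <= psi z] y)%:E)%E \is a fin_num.
        by near: K.
      rewrite -(fineK Kfin) lee_fin.
      have : `|0 - fine (sup_nonneg PP (fun P : probability (Omega R) R =>
        \int[marginal P 0]_y (psi y * \1_[set z : R | K <= psi z] y)%:E)%E)| <= tau.
        by near: K.
      by rewrite sub0r normrN; apply: le_trans; exact: ler_norm.
    (* [hK] holds strictly above [K], so [N] is taken with [K < N * a]. *)
    exists (Num.truncn (K / a)).+1 => P PPP.
    apply: le_trans (hK ((Num.truncn (K / a)).+1%:R * a) _).
      exact: (@sup_nonneg_ubound _ _ PP (fun P : probability (Omega R) R =>
        \int[marginal P 0]_y (psi y * \1_[set z : R | _ <= psi z] y)%:E)%E).
    by rewrite -ltr_pdivrMr// truncnS_gt.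
  pose m := (Num.truncn (2 / a)).+1.
  have ma : m%:R^-1 *+ 2 <= a.
    rewrite -[leLHS]mulr_natl ler_pdivrMr ?ltr0n// mulrC -ler_pdivrMr//.
    by apply/ltW; exact: truncnS_gt.
  (* [m] and [N] are fixed before [n] and serve the whole class, so the mixing term is a constant
     times a Cesàro mean tending to 0. *)
  pose L := (m.*2 + N)%:R * (a / (1 + a * N%:R)) ^- 2 * 2.
  have Lv_cvg : L * v n @[n --> \oo] --> (0 : R).
    by rewrite -(mulr0 L); apply: cvgMr.
  have kappa2 : 0 < kappa / 2 by rewrite divr_gt0.
  move/cvgrPdist_le : Lv_cvg => /(_ _ kappa2); apply: filterS => n Lv.
  apply: sup_nonneg_le => [|P PPP]; first by rewrite lee_fin ltW.
  rewrite aE.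
  apply: (le_trans (@d_psi_Levy_deviation _ psi psi_ge0 mpsi P c a m N n _ c0
    (alphac _ PPP) a0 isT ma _)).
  - exact: ident_marginals.
  - by rewrite (le_trans (tailN P PPP))// lee_fin ge_min lexx.
  - rewrite (splitr kappa) EFinD; apply: leeD.
      rewrite lee_fin; move: Lv; rewrite sub0r normrN.
      apply: le_trans; rewrite (le_trans _ (ler_norm _))//.
      by rewrite /L /v !mulrA.
    rewrite lee_pdivrMl// (le_trans (tailN P PPP))// lee_fin ge_min.
    by rewrite mulrC lexx orbT.
(* Convergence in the extended reals also asks for eventual finiteness, obtained from the bound with
   [kappa = 1]. *)
apply/fine_cvgP; split.
  apply: filterS (ev_small 1 ltr01) => n /le_lt_trans/(_ (ltry _)) h.
  by rewrite ge0_fin_numE ?sup_nonneg_ge0.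
apply/cvgrPdist_le => kappa kappa0; apply: filterS (ev_small kappa kappa0) => n hn /=.
rewrite sub0r normrN ger0_norm ?fine_ge0 ?sup_nonneg_ge0//.
rewrite -lee_fin fineK// ge0_fin_numE ?sup_nonneg_ge0//.
exact: le_lt_trans hn (ltry _).
Unshelve. all: by end_near. Qed.
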